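(* Let $G$ be a finite connected $D$-regular graph. Fix an arbitrary orientation of the edges of $G$, and for edges $e=\vec{xy}$ (oriented from $x$ to $y$) and $f$ of $G$ let $H(e,f)$ be the expected signed number of transits of $f$ by a simple random walk on $G$ started at $x$ and stopped when it first hits $y$. For distinct edges $e_1,\dots,e_k$ of $G$ let $M(e_1,\dots,e_k)$ be the $k\times k$ matrix whose $(i,j)$-entry is $H(e_i,e_j)$. If $\mathbf{T}$ is a random spanning tree of $G$, uniformly distributed among all spanning trees of $G$, then $$\mathbf{P}(e_1,\dots,e_k\in\mathbf{T})=\det M(e_1,\dots,e_k).$$
   Context: Graphs may have parallel edges and self-edges. $D$-regular means that every vertex has exactly $D$ incident edges, counted with multiplicity, each self-edge being counted once. Simple random walk chooses at each step one of the $D$ edges incident to its current position, uniformly, and traverses it. A transit of $f$ in the direction of its orientation counts $+1$ and a transit in the opposite direction counts $-1$ (a self-edge has signed number of transits $0$). The walk is stopped at time $0$ if $x=y$. *)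

(* Defs.v *)
From HB Require Import structures.
From mathcomp Require Import all_boot all_order all_algebra.
From mathcomp Require Import all_classical all_reals all_analysis.

Set Implicit Arguments.
Unset Strict Implicit.
Unset Printing Implicit Defensive.

Import Order.TTheory GRing.Theory Num.Theory.
Local Open Scope classical_set_scope.
Local Open Scope ring_scope.

(* Finite multigraphs: parallel edges are distinct elements of [edge] with the
   same [ends], and a self-edge has a singleton as its set of ends. *)
Record multigraph := Multigraph {
  vertex : finType;
  edge : finType;
  ends : edge -> {set vertex};
  ends_card : forall e, (0 < #|ends e| <= 2)%N }.

Record orientation (G : multigraph) := Orientation {
  src : edge G -> vertex G;
  dst : edge G -> vertex G;
  src_dst : forall e, ends e = [set src e; dst e]%SET }.

Section Graph.
Variable G : multigraph.
Implicit Types (S : {set edge G}) (u v : vertex G).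

(* Incidence is membership, so a self-edge contributes 1 to the degree. *)
Definition incident v : {set edge G} := [set e | v \in ends e]%SET.

Definition regular (D : nat) : Prop := forall v, #|incident v| = D.

Definition adjacent S : rel (vertex G) :=
  [rel u v | [exists e in S, ends e == [set u; v]%SET]].

Definition connected_by S : Prop :=
  (0 < #|vertex G|)%N /\ forall u v, connect (adjacent S) u v.

Definition connected_graph : Prop := connected_by [set: edge G]%SET.

(* The cycle visits v_0, ..., v_n and returns to v_0 (ordS is the cyclic
   successor); n = 0 is a self-edge and n = 1 a pair of parallel edges. *)
Definition cycle_in S (n : nat)
    (v : 'I_n.+1 -> vertex G) (c : 'I_n.+1 -> edge G) : Prop :=
  [/\ injective v, injective c, forall i, c i \in S &
      forall i, ends (c i) = [set v i; v (ordS i)]%SET].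

Definition acyclic S : Prop :=
  forall n (v : 'I_n.+1 -> vertex G) (c : 'I_n.+1 -> edge G),
    ~ cycle_in S v c.

Definition spanning_tree S : Prop := connected_by S /\ acyclic S.

Definition spanning_trees : {set {set edge G}} :=
  [set S | `[< spanning_tree S >]]%SET.

End Graph.

Section Probability.
Variables (R : realType) (G : multigraph).
Variables (d : measure_display) (Omega : measurableType d).
Variable P : probability Omega R.

(* X n is the position at time n, and A n the edge traversed between the times
   n and n.+1. By srw_traverse, A n is incident to X n and X n.+1 is its other
   end (X n itself if A n is a self-edge). *)
Record simple_random_walk (x : vertex G)
    (X : nat -> Omega -> vertex G) (A : nat -> Omega -> edge G) : Prop :=
  SimpleRandomWalk {
  srw_measurable_pos : forall n v, measurable [set w | X n w = v];
  srw_measurable_edge : forall n a, measurable [set w | A n w = a];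
  srw_start : forall w, X 0%N w = x;
  srw_traverse : forall n w, ends (A n w) = [set X n w; X n.+1 w]%SET;
  srw_uniform : forall n (v : nat -> vertex G) (a : nat -> edge G),
    let past := [set w | (forall i, (i <= n)%N -> X i w = v i) /\
                         (forall i, (i < n)%N -> A i w = a i)] in
    a n \in incident (v n) ->
    P (past `&` [set w | A n w = a n]) =
      (#|incident (v n)|%:R^-1%:E * P past)%E }.

Record uniform_spanning_tree (T : Omega -> {set edge G}) : Prop :=
  UniformSpanningTree {
  ust_measurable : forall S, measurable [set w | T w = S];
  ust_tree : forall w, spanning_tree (T w);
  ust_uniform : forall S, spanning_tree S ->
    P [set w | T w = S] = (#|spanning_trees G|%:R^-1)%:E }.

(* Signed contribution to the transits of f of a step along the edge a from u
   to v; the two indicators cancel when f is a self-edge. *)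
Definition transit (o : orientation G) (f a : edge G) (u v : vertex G) : R :=
  if a == f then ((u == src o f) && (v == dst o f))%:R -
                 ((u == dst o f) && (v == src o f))%:R
  else 0.

Definition hitting_time (X : nat -> vertex G) (y : vertex G) : option nat :=
  if pselect (exists n, X n == y) is left hit then Some (ex_minn hit) else None.

(* The value 0 on trajectories that never hit y is a convention on an event of
   probability zero when the graph is connected. *)
Definition signed_transits (o : orientation G) (f : edge G) (y : vertex G)
    (X : nat -> vertex G) (A : nat -> edge G) : R :=
  if hitting_time X y is Some t
  then \sum_(n < t) transit o f (A n) (X n) (X n.+1) else 0.

Definition expected_transits (o : orientation G) (f : edge G) (y : vertex G)
    (X : nat -> Omega -> vertex G) (A : nat -> Omega -> edge G) : R :=
  fine 'E_P[fun w => signed_transits o f y (X ^~ w) (A ^~ w)].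

End Probability.

(* X e, A e is the walk used for the row of e: it is to be started at the source
   of e and is stopped at the first visit to the destination of e. *)
Definition transfer_matrix (R : realType) (G : multigraph) (o : orientation G)
    (d : measure_display) (Omega : measurableType d) (P : probability Omega R)
    (X : edge G -> nat -> Omega -> vertex G)
    (A : edge G -> nat -> Omega -> edge G)
    (k : nat) (e : 'I_k -> edge G) : 'M[R]_k :=
  \matrix_(i, j) expected_transits P o (e j) (dst o (e i)) (X (e i)) (A (e i)).

(* Main.v *)
(* Write b_a for the signed incidence row of an edge a and L = sum_a b_a^T b_a
   for the Laplacian, reduced by deleting the coordinate of a root.  The expected
   number of visits to v of the walk killed at y, divided by D, is a potential g
   with L g = b_e, and H(e, f) is the potential difference of g along f; hence
   M = B L^-1 B^T, where B has rows b_{e_1}, ..., b_{e_k}.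
   Give weight X to the edges e_i and weight 1 to the others.  By the weighted
   matrix-tree theorem, the sum over spanning trees S of X^#|S :&: {e_i}| is
   det (L + (X - 1) B^T B) = det L * det (1 + (X - 1) M), and det L counts the
   spanning trees.  Comparing the coefficients of X^k gives the theorem. *)

Require Import Defs.
From mathcomp Require Import all_boot all_order fingroup perm all_algebra.
From mathcomp Require Import all_classical all_reals all_analysis.
From mathcomp Require Import measurable_realfun zify lra.

Set Implicit Arguments.
Unset Strict Implicit.
Unset Printing Implicit Defensive.

Import Order.TTheory GRing.Theory Num.Theory.
Import numFieldNormedType.Exports.
Local Open Scope ring_scope.

(** * Spanning trees and the reduced incidence matrix *)

Section Incidence.
Variables (G : multigraph) (o : orientation G).
Implicit Types (S : {set edge G}) (a b : edge G) (u v : vertex G).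

(** A self-edge gets the zero row, in agreement with its signed number of transits being 0. *)
Definition boundary (R : pzRingType) a v : R :=
  (v == src o a)%:R - (v == dst o a)%:R.

Lemma sum_boundary (R : pzRingType) a (phi : vertex G -> R) :
  \sum_v boundary R a v * phi v = phi (src o a) - phi (dst o a).
Proof.
have delta w : \sum_v (v == w)%:R * phi v = phi w.
  rewrite (bigD1 w) //= eqxx mul1r big1 ?addr0 // => v /negPf ->.
  by rewrite mul0r.
by under eq_bigr do rewrite mulrBl; rewrite sumrB !delta.
Qed.

Lemma endsP a u v : ends a = [set u; v]%SET ->
  (src o a = u /\ dst o a = v) \/ (src o a = v /\ dst o a = u).
Proof.
rewrite (src_dst o) => E.
have: (src o a == u) || (src o a == v) by rewrite -in_set2 -E set21.
have: (dst o a == u) || (dst o a == v) by rewrite -in_set2 -E set22.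
have: (u == src o a) || (u == dst o a) by rewrite -in_set2 E set21.
have: (v == src o a) || (v == dst o a) by rewrite -in_set2 E set22.
do 4! [case/orP => /eqP ?]; subst; intuition congruence.
Qed.

Lemma adjacent_sym S : symmetric (Defs.adjacent S).
Proof. by move=> u v; apply: eq_existsb => a; rewrite finset.setUC. Qed.

Lemma connect_adjacent_sym S u v :
  connect (Defs.adjacent S) u v = connect (Defs.adjacent S) v u.
Proof. exact: (sym_connect_sym (@adjacent_sym S)). Qed.

Lemma adjacentP S u v :
  reflect (exists2 a, a \in S & ends a = [set u; v]%SET) (Defs.adjacent S u v).
Proof. by apply: (iffP exists_inP) => -[a aS /eqP]; exists a => //; exact/eqP. Qed.

Lemma adjacent_src_dst S a : a \in S -> Defs.adjacent S (src o a) (dst o a).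
Proof. by move=> aS; apply/adjacentP; exists a => //; exact: src_dst. Qed.

Lemma eq_connected (C : Type) S (phi : vertex G -> C) :
  (forall a, a \in S -> phi (src o a) = phi (dst o a)) ->
  forall u v, connect (Defs.adjacent S) u v -> phi u = phi v.
Proof.
move=> phiS u v /connectP[p pth ->].
elim: p u pth => //= w p IHp u /andP[/adjacentP[a aS /endsP E] /IHp <-].
by case: E => -[<- <-]; rewrite phiS.
Qed.

(* A shortest path joining the ends of a in S minus a closes up to a cycle. *)
Lemma acyclic_bridge S a : acyclic S -> a \in S ->
  ~~ connect (Defs.adjacent (S :\ a)%SET) (src o a) (dst o a).
Proof.
move=> acS aS; apply/negP => /connectP[p0 pth0].
case/shortenP: pth0 => p pth Up _ lastp {p0}.
pose vs := src o a :: p.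
pose v (i : 'I_(size p).+1) := nth (src o a) vs i.
(* The last index [size p] carries the closing edge [a]; each smaller index carries an edge of S
   minus [a] along the path. *)
have /fin_all_exists[c cs] (i : 'I_(size p).+1) : exists b,
    if (i < size p)%N then b \in (S :\ a)%SET /\
      ends b = [set v i; nth (src o a) vs i.+1]%SET else b = a.
  case: (boolP (i < size p)%N) => [ip|_]; last by exists a.
  have /adjacentP[b] := pathP (src o a) pth i ip.
  by exists b.
have cP (i : 'I_(size p).+1) : (i < size p)%N ->
  c i \in (S :\ a)%SET /\ ends (c i) = [set v i; nth (src o a) vs i.+1]%SET.
  by move=> ip; move: (cs i); rewrite ip.
have cE (i : 'I_(size p).+1) : (i < size p)%N = false -> c i = a.
  by move=> ip; move: (cs i); rewrite ip.
have iE (i : 'I_(size p).+1) : (i < size p)%N = false -> i = size p :> nat.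
  by move=> ip; apply/eqP; rewrite eqn_leq -ltnS ltn_ord leqNgt ip.
have vinj : injective v.
  by move=> i j /eqP; rewrite /v nth_uniq //= => /eqP /val_inj.
apply: (acS _ v c); split=> //.
- move=> i j; case: (boolP (i < size p)%N) => [ip|/negbTE ip];
    case: (boolP (j < size p)%N) => [jp|/negbTE jp] cij.
  (* Equal edges have the same ends, and the vertices of the path are distinct, so the two positions
     agree. *)
  + have [_ Ei] := cP _ ip; have [_ Ej] := cP _ jp.
    have: v i \in ends (c j) by rewrite -cij Ei set21.
    have: nth (src o a) vs i.+1 \in ends (c j) by rewrite -cij Ei set22.
    rewrite Ej !inE /v !nth_uniq //= ?ltnS 1?ltnW // => ? ?.
    by apply: val_inj => /=; lia.
  + by have [] := cP _ ip; rewrite cij cE // !inE eqxx.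
  + by have [] := cP _ jp; rewrite -cij cE // !inE eqxx.
  + by apply: val_inj => /=; rewrite (iE i ip) (iE j jp).
- move=> i; case: (boolP (i < size p)%N) => [/cP[]|/negbTE/cE ->//].
  by rewrite !inE => /andP[].
- move=> i; case: (boolP (i < size p)%N) => [ip|/negbTE ip].
    by have [_ ->] := cP _ ip; rewrite /v /= modn_small.
  rewrite cE // (src_dst o) finset.setUC /v /= iE // modnn /=.
  by rewrite lastp (last_nth (src o a)).
Qed.

(** The family [f] may repeat edges, as the tuples in Cauchy-Binet do. Deleting the column of the
    root removes the relation that all columns sum to zero. *)
Definition reduced_incidence (R : pzRingType) (r : vertex G) p
    (f : 'I_p -> edge G) : 'M[R]_(p, #|[set~ r]%SET|) :=
  \matrix_(i, j) boundary R (f i) (enum_val j).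

Lemma sum_nonroot (R : nmodType) (r : vertex G) (F : vertex G -> R) :
  F r = 0 -> \sum_(j < #|[set~ r]%SET|) F (enum_val j) = \sum_v F v.
Proof.
move=> Fr; rewrite -(big_enum_val F) [RHS](bigD1 r) //= Fr add0r.
by apply: eq_bigl => v; rewrite !inE.
Qed.

(** A potential that vanishes at [r] loses nothing when its root coordinate is dropped, so the
    reduced matrix acts on it as the discrete gradient, up to sign. *)
Lemma reduced_incidence_mul (R : pzRingType) (r : vertex G) p
    (f : 'I_p -> edge G) (phi : vertex G -> R) : phi r = 0 ->
  reduced_incidence R r f *m (\col_j phi (enum_val j)) =
  \col_i (phi (src o (f i)) - phi (dst o (f i))).
Proof.
move=> phir; apply/colP => i; rewrite !mxE -sum_boundary.
under eq_bigr do rewrite !mxE.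
by rewrite (@sum_nonroot _ r (fun v => boundary R (f i) v * phi v)) ?phir ?mulr0.
Qed.

(** Deleting [a] separates its ends. The potential is the indicator of the component of [src o a]
    after the deletion, shifted by a constant to vanish at [r]. *)
Lemma bridge_potential (r : vertex G) S a : acyclic S -> a \in S ->
  exists phi : vertex G -> int, [/\ phi r = 0,
    phi (src o a) - phi (dst o a) = 1 &
    forall b, b \in S -> b != a -> phi (src o b) = phi (dst o b)].
Proof.
move=> acS aS; pose C v := connect (Defs.adjacent (S :\ a)%SET) (src o a) v.
exists (fun v => (C v)%:R - (C r)%:R); split; rewrite ?subrr //.
  rewrite opprB addrA subrK /C connect0.
  by rewrite (negbTE (acyclic_bridge acS aS)) subr0.
move=> b bS ba; congr (_%:R - _); congr nat_of_bool; apply: same_connect_r.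
  exact/sym_connect_sym/adjacent_sym.
by apply/connect1/adjacent_src_dst; rewrite !inE ba.
Qed.

(* Column i is the indicator of one side of the bridge f i, up to a constant;
   integrality of the inverse forces the determinant of a tree to be 1 or -1. *)
Lemma acyclic_right_inverse (r : vertex G) p (f : 'I_p -> edge G) :
  injective f -> acyclic (f @: [set: 'I_p])%SET ->
  exists Phi, reduced_incidence int r f *m Phi = 1%:M.
Proof.
move=> finj acf.
have fS i : f i \in (f @: [set: 'I_p])%SET by apply/imset_f; rewrite !inE.
have /fin_all_exists[phi phiP] i := bridge_potential r acf (fS i).
exists (\matrix_(j, i) phi i (enum_val j)); apply/matrixP => i k.
have [phir phi1 phi0] := phiP k.
have := reduced_incidence_mul f phir => /colP/(_ i); rewrite !mxE.
under eq_bigr do rewrite !mxE.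
under [in X in _ -> X]eq_bigr do rewrite !mxE.
move=> ->; case: eqVneq => [->//|ik].
by rewrite phi0 ?subrr // inj_eq.
Qed.

Lemma det_kernel (R : idomainType) n (A : 'M[R]_n) (x : 'cV[R]_n) :
  \det A != 0 -> A *m x = 0 -> x = 0.
Proof.
rewrite -det_tr => /det0P detA Ax; apply/eqP/negPn/negP => x0.
by apply: detA; exists x^T; rewrite ?trmx_eq0 // -trmx_mul Ax trmx0.
Qed.

Lemma col_nonroot (R : nmodType) (r : vertex G) (x : 'cV[R]_(#|[set~ r]%SET|)) :
  exists2 phi : vertex G -> R, phi r = 0 & x = \col_j phi (enum_val j).
Proof.
exists (fun v => if [pick j | enum_val j == v] is Some j then x j 0 else 0).
  case: pickP => // i /eqP ir.
  by have := enum_valP i; rewrite ir !inE eqxx.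
apply/colP => j; rewrite mxE; case: pickP => [i /eqP/enum_val_inj ->//|].
by move=> /(_ j); rewrite eqxx.
Qed.

(** A kernel vector is a potential that takes equal values at the ends of every edge of S;
    connectedness makes it constant, equal to its value 0 at the root. *)
Lemma connected_kernel (R : pzRingType) (r : vertex G) S p
    (f : 'I_p -> edge G) (x : 'cV[R]_(#|[set~ r]%SET|)) :
  connected_by S -> S \subset (f @: [set: 'I_p])%SET ->
  reduced_incidence R r f *m x = 0 -> x = 0.
Proof.
move=> [_ conS] Sf fx.
have [phi phir xE] := col_nonroot x.
have phiS a : a \in S -> phi (src o a) = phi (dst o a).
  move=> /(fintype.subsetP Sf)/imsetP[i _ ->]; apply/eqP; rewrite -subr_eq0; apply/eqP.
  have := reduced_incidence_mul f phir; rewrite -xE fx => /colP/(_ i).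
  by rewrite !mxE.
rewrite xE; apply/colP => j; rewrite !mxE -phir.
exact: eq_connected phiS _ _ (conS _ _).
Qed.

(** Both inequalities come from linear algebra. Acyclicity gives the incidence matrix a right
    inverse, so it has at most as many rows as columns; with fewer rows it would have a nonzero
    kernel vector over the rationals, against connectedness. *)
Lemma spanning_tree_card (r : vertex G) S :
  spanning_tree S -> #|S| = #|[set~ r]%SET|.
Proof.
move=> [conS acS]; pose f (i : 'I_#|S|) : edge G := enum_val i.
have imf : (f @: [set: 'I_#|S|])%SET = S.
  apply/setP => a; apply/imsetP/idP => [[i _ ->]|aS]; first exact: enum_valP.
  by exists (enum_rank_in aS a) => //; rewrite /f enum_rankK_in.
apply/eqP; rewrite eqn_leq; apply/andP; split.
  have [|Phi] := @acyclic_right_inverse r _ f enum_val_inj; first by rewrite imf.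
  exact: mulmx1_min.
rewrite leqNgt; apply/negP => ltSn.
pose B := reduced_incidence rat r f.
have : ~~ row_free B^T.
  by rewrite /row_free mxrank_tr neq_ltn (leq_ltn_trans (rank_leq_row B)).
rewrite -kermx_eq0 => /rowV0Pn[x /sub_kermxP xB]; apply/negP/negPn.
rewrite -trmx_eq0; apply/eqP; apply: (connected_kernel (f := f) conS).
  by rewrite imf.
by rewrite -/B -[B]trmxK -trmx_mul xB trmx0.
Qed.

(** The edges of a cycle, signed by the sense in which they are traversed, have boundaries that
    cancel around the cycle. The combination is nonzero because the edges are distinct. *)
Lemma cycle_kernel (r : vertex G) p (f : 'I_p -> edge G) m
    (v : 'I_m.+1 -> vertex G) c :
  cycle_in (f @: [set: 'I_p])%SET v c ->
  exists2 y : 'rV[int]_p, y != 0 & y *m reduced_incidence int r f = 0.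
Proof.
move=> [vinj cinj cS cends].
have /fin_all_exists[j jc] i : exists j, f j = c i.
  by have /imsetP[j _ ->] := cS i; exists j.
have jinj : injective j by move=> i i' jij; apply: cinj; rewrite -!jc jij.
pose s i : int := if src o (c i) == v i then 1 else -1.
have sE i w : s i * boundary int (c i) w = (w == v i)%:R - (w == v (ordS i))%:R.
  rewrite /s /boundary; have [[-> ->]|[-> ->]] := endsP (cends i).
    by rewrite eqxx mul1r.
  by case: eqP => [->|_]; rewrite ?subrr ?mulr0 // mulN1r opprB.
exists (\sum_i s i *: delta_mx 0 (j i)).
  apply/eqP => /rowP/(_ (j ord0)); rewrite summxE (bigD1 ord0) //= big1.
    by rewrite !mxE !eqxx mulr1 addr0 /s; case: ifP.
  move=> i i0; rewrite !mxE (inj_eq jinj).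
  by rewrite eq_sym (negbTE i0) mulr0.
rewrite mulmx_suml; apply/rowP => l; rewrite summxE mxE.
under eq_bigr => i _ do rewrite -scalemxAl -rowE !mxE jc sE.
rewrite sumrB; apply/eqP; rewrite subr_eq0; apply/eqP.
by rewrite (reindex_inj (@ordS_inj _)).
Qed.

(** Each failure makes the determinant vanish: a repeated edge gives two equal rows, a cycle gives a
    vector of the left kernel, and if some vertex cannot be reached from [r], the indicator of all
    such vertices lies in the right kernel. *)
Lemma det_neq0_spanning_tree (r : vertex G)
    (f : 'I_#|[set~ r]%SET| -> edge G) :
  \det (reduced_incidence int r f) != 0 ->
  injective f /\ spanning_tree (f @: [set: 'I_#|[set~ r]%SET|])%SET.
Proof.
move=> det0; have finj : injective f.
  move=> i j fij; apply/eqP/negPn/negP => ij; move/negP: det0; apply; apply/eqP.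
  by apply: (determinant_alternate ij) => l; rewrite !mxE fij.
split=> //; split; last first.
  by move=> m v c /(cycle_kernel r)[y y0 yB]; move/det0P: det0; apply; exists y.
split; first by apply/card_gt0P; exists r.
pose S := (f @: [set: 'I_#|[set~ r]%SET|])%SET.
suff con u : connect (Defs.adjacent S) r u.
  by move=> u v; apply: connect_trans (con v); rewrite connect_adjacent_sym.
apply/negPn/negP => ru.
pose phi v : int := (~~ connect (Defs.adjacent S) r v)%:R.
have phir : phi r = 0 by rewrite /phi connect0.
have ur : u \in [set~ r]%SET by rewrite !inE; apply: contraNneq ru => ->.
have := det_kernel det0 (x := \col_j phi (enum_val j)).
rewrite reduced_incidence_mul //.
have -> : \col_i (phi (src o (f i)) - phi (dst o (f i))) = 0.
  apply/colP => i; rewrite !mxE /phi.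
  rewrite (same_connect_r (sym_connect_sym (@adjacent_sym S))
    (y := dst o (f i))) ?subrr //.
  by apply/connect1/adjacent_src_dst/imset_f; rewrite !inE.
move=> /(_ erefl)/colP/(_ (enum_rank_in ur u)).
by rewrite !mxE enum_rankK_in // /phi ru.
Qed.

Lemma det_reduced_incidence_sqr (r : vertex G)
    (f : 'I_#|[set~ r]%SET| -> edge G) :
  \det (reduced_incidence int r f) ^+ 2 =
  (injectiveb f && `[< spanning_tree (f @: [set: 'I_#|[set~ r]%SET|])%SET >])%:R.
Proof.
have [/andP[/injectiveP finj /asboolP[_ acf]]|nt] := boolP (_ && _); last first.
  have [->|/det_neq0_spanning_tree[finj fT]] :=
    eqVneq (\det (reduced_incidence int r f)) 0; first by rewrite expr0n.
  by case/negP: nt; apply/andP; split; [exact/injectiveP|exact/asboolP].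
have [Phi /(congr1 determinant)] := acyclic_right_inverse r finj acf.
rewrite det_mulmx det1 => /(congr1 absz); rewrite abszM => /eqP.
rewrite muln_eq1 => /andP[/eqP d1 _].
by rewrite [\det _]intEsign d1 mulr1 sqrr_sign.
Qed.
End Incidence.

(** * The matrix-tree theorem *)

(* The n-subsets of Cauchy-Binet are replaced by n-tuples, hence the factor n!. *)
Lemma cauchy_binet_sym (R : comPzRingType) (I : finType) n
    (A : 'I_n -> I -> R) (B : I -> 'I_n -> R) :
  n`!%:R * \det (\matrix_(i, j) \sum_a A i a * B a j) =
  \sum_(f : {ffun 'I_n -> I})
    \det (\matrix_(i, j) A j (f i)) * \det (\matrix_(i, j) B (f i) j).
Proof.
pose detB (f : {ffun 'I_n -> I}) := \det (\matrix_(i, j) B (f i) j).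
(* Multilinearity in the rows of the product. *)
have -> : \det (\matrix_(i, j) \sum_a A i a * B a j) =
    \sum_(f : {ffun 'I_n -> I}) (\prod_i A i (f i)) * detB f.
  under [RHS]eq_bigr do rewrite mulr_sumr.
  rewrite exchange_big; apply: eq_bigr => s _.
  under eq_bigr do rewrite mxE.
  rewrite bigA_distr_bigA /= mulr_sumr; apply: eq_bigr => f _.
  rewrite big_split /= mulrCA; congr (_ * (_ * _)).
  by apply: eq_bigr => i _; rewrite mxE.
have detBs (f : {ffun 'I_n -> I}) (s : 'S_n) :
    detB [ffun i => f (s i)] = (-1) ^+ s * detB f.
  rewrite -det_perm -det_mulmx -row_permE; congr determinant.
  by apply/matrixP => i j; rewrite !mxE ffunE.
have reindex_s (F : {ffun 'I_n -> I} -> R) (s : 'S_n) :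
    \sum_f F f = \sum_(f : {ffun 'I_n -> I}) F [ffun i => f (s i)].
  rewrite (reindex (fun f : {ffun 'I_n -> I} => [ffun i => f (s i)])) //.
  exists (fun f : {ffun 'I_n -> I} => [ffun i => f (s^-1%g i)]) => f _;
    by apply/ffunP => i; rewrite !ffunE ?permK ?permKV.
(* Write n! as a sum over permutations and reindex the tuples by each of them: the signs come out of
   [detB], and the products of entries of A assemble into a determinant. *)
rewrite -card_Sn mulr_natl -sumr_const.
under eq_bigr => s _ do rewrite (reindex_s _ s).
rewrite exchange_big; apply: eq_bigr => f _ /=.
rewrite -det_tr mulr_suml; apply: eq_big => [s|s _]; first by rewrite inE.
rewrite detBs mulrCA mulrA; congr (_ * _ * _).
by apply: eq_bigr => i _; rewrite !mxE ffunE.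
Qed.

Section MatrixTree.
Variables (G : multigraph) (o : orientation G).

Lemma map_reduced_incidence (R S : pzRingType) (h : {rmorphism R -> S})
    (r : vertex G) p (f : 'I_p -> edge G) :
  map_mx h (reduced_incidence o R r f) = reduced_incidence o S r f.
Proof.
by apply/matrixP => i j; rewrite !mxE rmorphB !rmorph_nat.
Qed.

Definition weighted_laplacian (R : pzRingType) (r : vertex G) (w : edge G -> R) :
    'M[R]_(#|[set~ r]%SET|) :=
  \matrix_(i, j) \sum_a
     w a * boundary o R a (enum_val i) * boundary o R a (enum_val j).

(** Cauchy-Binet, with the weights put in one of the two factors. Only tuples enumerating a spanning
    tree contribute, each with squared determinant 1, and every tree is enumerated n! times;
    characteristic zero allows n! to be cancelled. *)
Theorem weighted_matrix_tree (R : idomainType) (r : vertex G) (w : edge G -> R) :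
  [pchar R] =i pred0 ->
  \det (weighted_laplacian r w) =
  \sum_(S in spanning_trees G) \prod_(a in S) w a.
Proof.
move=> charR; set n := #|[set~ r]%SET|.
have n0 : n`!%:R != 0 :> R.
  by rewrite natf_neq0_pchar; apply/pnatP; rewrite ?fact_gt0 // => p _ _;
     rewrite inE /= charR.
apply: (mulfI n0); rewrite cauchy_binet_sym.
pose tree (f : {ffun 'I_n -> edge G}) :=
  injectiveb f && ((f @: [set: 'I_n])%SET \in spanning_trees G).
transitivity (\sum_(f | tree f) \prod_(a in (f @: [set: 'I_n])%SET) w a).
  rewrite [RHS]big_mkcond; apply: eq_bigr => f _.
  have -> : \matrix_(i, j) (w (f i) * boundary o R (f i) (enum_val j)) =
      diag_mx (\row_i w (f i)) *m reduced_incidence o R r f.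
    by rewrite mul_diag_mx; apply/matrixP => i j; rewrite !mxE.
  rewrite det_mulmx det_diag -mulrA -expr2.
  (* The squared determinant is evaluated over the integers and transported to R. *)
  rewrite -(map_reduced_incidence (intmul 1 : {rmorphism int -> R})) det_map_mx -rmorphXn.
  rewrite det_reduced_incidence_sqr /tree inE.
  case: (boolP (injectiveb f)) => /= [/injectiveP finj|_]; last first.
    by rewrite mulr0.
  case: ifP => _; rewrite ?mulr0 // mulr1 big_imset /=; last by move=> ? ? _ _ /finj.
  by apply: eq_big => [i|i _]; rewrite ?inE // mxE.
rewrite (partition_big (fun f : {ffun 'I_n -> edge G} => (f @: [set: 'I_n])%SET)
  (mem (spanning_trees G))) /=; last by move=> f /andP[].
rewrite mulr_sumr; apply: eq_bigr => S ST.
rewrite (eq_bigr (fun=> \prod_(a in S) w a)); last by move=> f /andP[_ /eqP ->].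
rewrite sumr_const [RHS]mulr_natl; congr (_ *+ _).
have cardS : #|S| = n.
  by apply: spanning_tree_card; first exact: o; move: ST; rewrite inE => /asboolP.
transitivity #|[set f : {ffun 'I_n -> edge G} in ffun_on (mem S) | injectiveb f]%SET|;
  last first.
  by rewrite card_inj_ffuns_on /= cardS card_ord ffactnn.
apply: eq_card => f; rewrite !inE /tree.
apply/andP/andP => [[/andP[inj_f _] /eqP imf]|[/ffun_onP fS inj_f]].
  by split=> //; apply/ffun_onP => i; rewrite -imf; apply: imset_f; rewrite inE.
have imf : (f @: [set: 'I_n])%SET = S.
  apply/eqP; rewrite eqEcard card_imset ?cardsT ?card_ord ?cardS; last exact/injectiveP.
  by rewrite leqnn andbT; apply/fintype.subsetP => a /imsetP[i _ ->]; exact: fS.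
by rewrite inj_f imf ST eqxx.
Qed.
End MatrixTree.

(** * Trees containing prescribed edges, by coefficient extraction *)

(** Sylvester's identity: one block matrix is factored in two ways into block triangular
    matrices. *)
Lemma det_1Dmulmx_swap (R : comPzRingType) m n (A : 'M[R]_(m, n)) (B : 'M[R]_(n, m)) :
  \det (1%:M + A *m B) = \det (1%:M + B *m A).
Proof.
have AB : block_mx (1%:M + A *m B) (- A) 0 1%:M *m block_mx 1%:M 0 B 1%:M =
    block_mx 1%:M (- A) B 1%:M.
  by rewrite mulmx_block !mul0mx !mulmx1 !mul1mx !mulmx0 !add0r mulNmx addrK.
have BA : block_mx 1%:M 0 B 1%:M *m block_mx 1%:M (- A) 0 (1%:M + B *m A) =
    block_mx 1%:M (- A) B 1%:M.
  by rewrite mulmx_block !mul0mx !mulmx1 !mul1mx !addr0 mulmxN addrC addrK.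
have := congr1 determinant (etrans AB (esym BA)).
by rewrite !det_mulmx !det_ublock !det_lblock !det1 !mulr1 !mul1r.
Qed.

Lemma coef_prod_linear (R : comNzRingType) n (a b : 'I_n -> R) :
  (\prod_(i < n) ((a i)%:P + 'X * (b i)%:P) : {poly R})`_n = \prod_i b i.
Proof.
(* The degree bound is carried through the induction: it kills the contribution of the constant term
   of the last factor. *)
suff: (\prod_(i < n) ((a i)%:P + 'X * (b i)%:P) : {poly R})`_n = \prod_i b i /\
   (size (\prod_(i < n) ((a i)%:P + 'X * (b i)%:P) : {poly R})%R <= n.+1)%N by case.
elim: n a b => [|n IHn] a b; first by rewrite !big_ord0 coef1 size_poly1.
rewrite !big_ord_recr /=; set p := \prod_(i < n) _.
have [pn sp] := IHn (fun i => a (widen_ord (leqnSn n) i))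
  (fun i => b (widen_ord (leqnSn n) i)).
rewrite -/p in pn sp; split.
  rewrite mulrDr mulrCA coefD coefMC coefXM /= coefMC pn.
  by rewrite (nth_default _ sp) mul0r add0r.
apply: (leq_trans (size_polyMleq _ _)).
have sl : (size ((a ord_max)%:P + 'X * (b ord_max)%:P)%R <= 2)%N.
  apply: (leq_trans (size_polyD _ _)); rewrite geq_max.
  rewrite (leq_trans (size_polyC_leq1 _)) //=.
  apply: (leq_trans (size_polyMleq _ _)); rewrite size_polyX.
  exact: size_polyC_leq1.
lia.
Qed.

(** In each Leibniz product of n entries of degree at most 1, the power X^n arises only by taking
    the X-part of every factor. *)
Lemma coef_det_pencil (R : comNzRingType) n (A B : 'M[R]_n) :
  (\det (map_mx polyC A + 'X *: map_mx polyC B))`_n = \det B.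
Proof.
rewrite coef_sum; apply: eq_bigr => s _.
under eq_bigr do rewrite !mxE.
rewrite -(rmorph_sign (@polyC R)) coefCM; congr (_ * _).
exact: coef_prod_linear.
Qed.

Section TransferDeterminant.
Variables (G : multigraph) (o : orientation G).

Definition laplacian (R : pzRingType) (phi : vertex G -> R) v : R :=
  \sum_a boundary o R a v * (phi (src o a) - phi (dst o a)).

Lemma weighted_laplacian_mul (R : comPzRingType) (r : vertex G) (phi : vertex G -> R) :
  phi r = 0 ->
  weighted_laplacian o r (fun=> 1) *m (\col_j phi (enum_val j)) =
  \col_i laplacian phi (enum_val i).
Proof.
move=> phir; apply/colP => i; rewrite !mxE.
under eq_bigr do rewrite !mxE mulr_suml.
rewrite exchange_big; apply: eq_bigr => a _ /=.
under eq_bigr do rewrite mul1r -mulrA.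
rewrite -mulr_sumr; congr (_ * _).
by rewrite -sum_boundary -(@sum_nonroot _ _ r) ?phir ?mulr0.
Qed.

Theorem card_spanning_trees_containing (R : numFieldType) (r : vertex G)
    k (e : 'I_k -> edge G) (g : 'I_k -> vertex G -> R) :
  injective e ->
  (forall i v, laplacian (g i) v = boundary o R (e i) v) ->
  #|[set S in spanning_trees G | [forall i, e i \in S]]%SET|%:R =
  #|spanning_trees G|%:R *
    \det (\matrix_(i, j) (g i (src o (e j)) - g i (dst o (e j)))).
Proof.
move=> einj lap_g; set M := \matrix_(i, j) _; set n := #|[set~ r]%SET|.
pose L := weighted_laplacian o r (fun=> 1 : R).
pose B := reduced_incidence o R r e.
(* The potentials, shifted to vanish at [r], are the columns of L^-1 B^T, obtained without inverting
   L. *)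
pose C : 'M[R]_(n, k) := \matrix_(j, i) (g i (enum_val j) - g i r).
have LC : L *m C = B^T.
  apply/matrixP => j i.
  have := @weighted_laplacian_mul R r (fun v => g i v - g i r) (subrr _).
  move=> /colP/(_ j); rewrite !mxE.
  under eq_bigr do rewrite !mxE.
  under [X in _ -> X = _]eq_bigr do rewrite !mxE.
  move=> ->; rewrite -lap_g; apply: eq_bigr => a _.
  by rewrite opprB addrA subrK.
have BC : B *m C = M^T.
  apply/matrixP => j i; rewrite !mxE.
  have := @reduced_incidence_mul G o R r k e (fun v => g i v - g i r) (subrr _).
  move=> /colP/(_ j); rewrite !mxE.
  under eq_bigr do rewrite !mxE.
  under [X in _ -> X = _]eq_bigr do rewrite !mxE.
  by move=> ->; rewrite opprB addrA subrK.
pose E := (e @: [set: 'I_k])%SET.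
have cardE : #|E| = k by rewrite card_imset // cardsT card_ord.
pose w a : {poly R} := if a \in E then 'X else 1.
have detL : \det L = #|spanning_trees G|%:R.
  rewrite weighted_matrix_tree; last exact: pchar_num.
  by under eq_bigr do rewrite big1_eq; rewrite sumr_const.
(* Raising the weight of the edges in E from 1 to X adds (X - 1) B^T B to the Laplacian, and B^T is
   L C. *)
have LwE : weighted_laplacian o r w =
    map_mx polyC L *m (1%:M + map_mx polyC C *m (('X - 1) *: map_mx polyC B)).
  rewrite mulmxDr mulmx1 mulmxA -map_mxM LC -scalemxAr.
  apply/matrixP => i j; rewrite !mxE rmorph_sum.
  have -> : \sum_l (map_mx polyC B^T) i l * (map_mx polyC B) l j =
      \sum_(a in E) boundary o {poly R} a (enum_val i) *
                    boundary o {poly R} a (enum_val j).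
    rewrite big_imset /=; last by move=> ? ? _ _ /einj.
    apply: eq_big => [l|l _]; first by rewrite inE.
    by rewrite !mxE !(rmorphB, rmorph_nat).
  rewrite [X in _ + _ * X]big_mkcond mulr_sumr -big_split /=; apply: eq_bigr => a _.
  rewrite /w !(rmorphM, rmorphB, rmorph_nat, rmorph1) mul1r -mulrA.
  rewrite -/(boundary o {poly R} a (enum_val i))
    -/(boundary o {poly R} a (enum_val j)).
  set b := boundary _ _ _ _ * _.
  case: ifP => _; last by rewrite mulr0 addr0 mul1r.
  by rewrite mulrBl mul1r addrC subrK.
have := @weighted_matrix_tree G o {poly R} r w.
(* The swap replaces an n by n determinant by that of the k by k pencil (1 - M^T) + X M^T, whose
   coefficient of degree k is det M. *)
rewrite LwE det_mulmx det_map_mx detL det_1Dmulmx_swap.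
have -> : 1%:M + (('X - 1) *: map_mx polyC B) *m map_mx polyC C =
    map_mx polyC (1%:M - M^T) + 'X *: map_mx polyC M^T.
  rewrite -scalemxAl -map_mxM BC map_mxB map_mx1 scalerBl scale1r.
  by rewrite addrA addrAC.
move=> /(_ _)/(congr1 (fun p : {poly R} => p`_k)).
rewrite coefCM coef_det_pencil det_tr => ->; last first.
  by move=> p; rewrite pchar_poly pchar_num.
rewrite coef_sum -sum1_card natr_sum.
rewrite [RHS]big_mkcond /= [LHS]big_mkcond; apply: eq_bigr => S _; rewrite !inE.
case: (`[< spanning_tree S >]) => //=.
(* A tree contributes X to the number of the [e i] that it contains; these being k distinct edges,
   the coefficient of X^k selects the trees containing all of them. *)
have -> : \prod_(a in S) w a = 'X ^+ #|S :&: E|%SET.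
  rewrite (bigID (mem E)) /= [X in _ * X]big1 ?mulr1; last first.
    by move=> a /andP[_ /negbTE aE]; rewrite /w aE.
  rewrite (eq_bigr (fun=> 'X)); last by move=> a /andP[_ aE]; rewrite /w aE.
  by rewrite prodr_const; congr ('X ^+ _); apply: eq_card => a; rewrite !inE.
have -> : [forall i, e i \in S] = (E \subset S).
  apply/forallP/fintype.subsetP => [eS a /imsetP[i _ ->]//|ES i].
  by apply/ES/imset_f; rewrite inE.
have -> : (E \subset S) = (k == #|S :&: E|%SET).
  rewrite -(sameP eqP (@finset.setIidPr _ S E)) eqEcard finset.subsetIr cardE /=.
  have: (#|S :&: E|%SET <= k)%N.
    by rewrite -[X in (_ <= X)%N]cardE subset_leq_card ?finset.subsetIr.
  by rewrite eqn_leq => ->; rewrite andbT.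
by rewrite coefXn; case: (_ == _).
Qed.
End TransferDeterminant.

(** * Potentials and killed walks *)

Section Potential.
Variables (G : multigraph) (o : orientation G).
Implicit Types (a : edge G) (u v : vertex G).

(** Green's identity: both sides equal the Dirichlet pairing, a sum over edges that is symmetric in
    the two functions. *)
Lemma laplacian_sym (R : comPzRingType) (phi psi : vertex G -> R) :
  \sum_v psi v * laplacian o phi v = \sum_v phi v * laplacian o psi v.
Proof.
have energy (f g : vertex G -> R) : \sum_v f v * laplacian o g v =
    \sum_a (f (src o a) - f (dst o a)) * (g (src o a) - g (dst o a)).
  under eq_bigr do rewrite mulr_sumr.
  rewrite exchange_big; apply: eq_bigr => a _ /=.
  rewrite -(sum_boundary o a f) mulr_suml; apply: eq_bigr => v _.
  by rewrite mulrA [f v * _]mulrC.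
by rewrite !energy; apply: eq_bigr => a _; rewrite mulrC.
Qed.

Lemma sum_laplacian (R : comPzRingType) (phi : vertex G -> R) :
  \sum_v laplacian o phi v = 0.
Proof.
have := laplacian_sym phi (fun=> 1).
under eq_bigr do rewrite mul1r.
move=> ->; apply: big1 => v _; rewrite /laplacian big1 ?mulr0 // => a _.
by rewrite subrr mulr0.
Qed.

(* Meaningful only when v is an end of a. *)
Definition across a v := if v == src o a then dst o a else src o a.

Lemma incidentE a v : (a \in incident v) = (v == src o a) || (v == dst o a).
Proof. by rewrite inE (src_dst o) in_set2. Qed.

Lemma incident_across a v : a \in incident v -> a \in incident (across a v).
Proof. by rewrite !incidentE /across; case: ifP; rewrite eqxx ?orbT. Qed.

Lemma endsE_across a v w : a \in incident v ->
  (ends a == [set w; v]%SET) = (w == across a v).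
Proof.
rewrite incidentE => av; apply/eqP/eqP => [/(endsP o)|->]; rewrite /across.
  case=> -[<- <-]; last by rewrite eqxx.
  by case: eqP => // ->.
rewrite (src_dst o); case: eqP av => [->|_] /=; first by rewrite finset.setUC.
by move/eqP ->.
Qed.

(** A self-edge at [v] counts 1 in D and gives back [phi v] in the sum, so it cancels, as its zero
    boundary requires. *)
Lemma laplacian_regular (R : comPzRingType) (D : nat) (phi : vertex G -> R) v :
  regular G D ->
  laplacian o phi v = D%:R * phi v - \sum_(a in incident v) phi (across a v).
Proof.
move=> regG; rewrite mulr_natl -(regG v) -sumr_const -sumrB [RHS]big_mkcond.
apply: eq_bigr => a _; rewrite incidentE /boundary /across.
case: (eqVneq v (src o a)) => [->|_] /=.
  case: eqP => [->|_]; first by rewrite !subrr mul0r.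
  by rewrite subr0 mul1r.
case: eqP => [->|_]; last by rewrite subrr mul0r.
by rewrite sub0r mulN1r opprB.
Qed.

(** The determinant of the reduced Laplacian is the number of spanning trees, hence nonzero; the
    equation at the root disappears with its row. *)
Lemma poisson_equation (R : numFieldType) (r : vertex G) (h : vertex G -> R) :
  (0 < #|spanning_trees G|)%N ->
  exists2 phi : vertex G -> R, phi r = 0 &
    forall v, v != r -> laplacian o phi v = h v.
Proof.
move=> trees; set n := #|[set~ r]%SET|.
pose L : 'M[R]_n := weighted_laplacian o r (fun=> 1 : R).
have Lunit : L \in unitmx.
  rewrite unitmxE weighted_matrix_tree; last exact: pchar_num.
  under eq_bigr do rewrite big1_eq.
  by rewrite sumr_const unitfE pnatr_eq0 -lt0n.
have [phi phir xE] := col_nonroot (invmx L *m (\col_j h (enum_val j))).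
exists phi => // v vr.
have vS : v \in [set~ r]%SET by rewrite !inE.
have := weighted_laplacian_mul o phir.
rewrite -xE mulKVmx // => /colP/(_ (enum_rank_in vS v)).
by rewrite !mxE enum_rankK_in.
Qed.
End Potential.

(** * The Green function of the killed walk *)

Section KilledWalk.
Local Open Scope classical_set_scope.
Variables (R : realType) (G : multigraph) (o : orientation G) (D : nat).
Variables (y : vertex G) (u : nat -> vertex G -> R).
Hypotheses (D0 : (0 < D)%N) (trees : (0 < #|spanning_trees G|)%N).
Hypotheses (u01 : forall n v, 0 <= u n v <= 1) (uy : forall n, u n y = 0).
Hypothesis uS : forall n v, v != y -> u n.+1 v = u n v - laplacian o (u n) v / D%:R.

Let green m v := \sum_(0 <= n < m) u n v.

(** The evolution equation expresses each Laplacian as a time increment, so the sum over times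
    telescopes. *)
Let laplacian_green m v : v != y -> laplacian o (green m) v = D%:R * (u 0 v - u m v).
Proof.
move=> vy; transitivity (\sum_(0 <= n < m) laplacian o (u n) v).
  rewrite /green /laplacian exchange_big; apply: eq_bigr => a _ /=.
  by rewrite -sumrB mulr_sumr.
rewrite -opprB -(telescope_sumr (u ^~ v) (leq0n m)) -sumrN mulr_sumr; apply: eq_bigr => n _.
by rewrite uS // addrAC subrr add0r opprK [RHS]mulrC mulfVK // pnatr_eq0 -lt0n.
Qed.

(* u n is the law at time n of the walk killed at y.  Pairing its partial sums
   with the hitting-time potential, whose laplacian is 1 off y, bounds them. *)
Lemma killed_walk_bounded :
  exists C, forall m, \sum_(0 <= n < m) \sum_v u n v <= C.
Proof.
have [phi phiy lap_phi] := @poisson_equation G o R y (fun=> 1) trees.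
exists (D%:R * \sum_v `|phi v|) => m.
rewrite exchange_big /=.
have -> : \sum_v green m v = \sum_v green m v * laplacian o phi v.
  apply: eq_bigr => v _; case: (eqVneq v y) => [->|/lap_phi ->]; last by rewrite mulr1.
  by rewrite /green big1 ?mul0r // => n _; rewrite uy.
rewrite laplacian_sym mulr_sumr; apply: ler_sum => v _.
case: (eqVneq v y) => [->|vy]; first by rewrite phiy normr0 mul0r mulr0.
rewrite laplacian_green // mulrCA ler_wpM2l ?ler0n //.
apply: le_trans (ler_norm _) _; rewrite normrM ler_piMr //.
have /andP[? ?] := u01 0 v; have /andP[? ?] := u01 m v.
by rewrite ler_norml; apply/andP; split; lra.
Qed.

(** The partial sums are nondecreasing and bounded, so they converge, and g is their limit divided
    by D. As terms of a convergent series the [u m v] tend to 0, so the telescoped equation keeps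
    only its initial term in the limit. *)
Lemma killed_walk_green :
  exists2 g : vertex G -> R,
    forall v, \sum_(0 <= n < m) u n v @[m --> \oo] --> D%:R * g v &
    forall v, v != y -> laplacian o g v = u 0 v.
Proof.
have [C uC] := killed_walk_bounded.
have cvgu v : cvgn (fun m => green m v).
  apply: nondecreasing_is_cvgn.
    move=> m n mn; rewrite /green [leRHS](big_cat_nat (n := m)) //= lerDl.
    by apply: sumr_ge0 => i _; have /andP[] := u01 i v.
  exists C => _ [m _ <-]; apply: le_trans (uC m).
  apply: ler_sum => n _; rewrite (bigD1 v) //= lerDl.
  by apply: sumr_ge0 => w _; have /andP[] := u01 n w.
pose g v := limn (fun m => green m v) / D%:R.
have gE v : D%:R * g v = limn (fun m => green m v).
  by rewrite /g mulrCA mulfV ?mulr1 // pnatr_eq0 -lt0n.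
exists g => [v|v vy]; first by rewrite gE; exact: cvgu.
have u0 : u m v @[m --> \oo] --> (0 : R).
  by apply: (@cvg_series_cvg_0 _ _ (fun m => u m v)); exact: cvgu.
have lapcvg : laplacian o (green m) v @[m --> \oo] --> D%:R * laplacian o g v.
  rewrite mulr_sumr; apply: (cvg_big add_continuous) => a _; rewrite mulrCA mulrBr !gE.
  by apply: cvgMl_tmp; apply: cvgB; exact: cvgu.
have : laplacian o (green m) v @[m --> \oo] --> D%:R * (u 0 v - 0).
  under eq_fun do rewrite laplacian_green //.
  by apply: cvgMl_tmp; apply: cvgB => //; exact: cvg_cst.
move=> /(cvg_unique (@norm_hausdorff _ _) lapcvg); rewrite subr0 => /mulfI; apply.
by rewrite pnatr_eq0 -lt0n.
Qed.
End KilledWalk.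

(** * The stopped random walk *)

Local Open Scope classical_set_scope.

Lemma measure_partition (d : measure_display) (T : measurableType d)
    (R : realType) (mu : {measure set T -> \bar R}) (Z : finType) (t : T -> Z)
    (B : set T) :
  measurable B -> (forall z, measurable (t @^-1` [set z])) ->
  mu B = (\sum_(z : Z) mu (B `&` t @^-1` [set z]))%E.
Proof.
move=> mB mt.
have BE : B = \bigcup_(z in [set: Z]) (B `&` t @^-1` [set z]).
  by apply/seteqP; split => [w Bw|w [z _ []]//]; exists (t w).
rewrite {1}BE measure_fin_bigcup; last 3 first.
- exact: finite_finset.
- by move=> z z' _ _ [w [[_ /= <-] [_ /= <-]]].
- by move=> z _; exact: measurableI.
have -> : [set: Z] = [set` index_enum Z].
  by apply/seteqP; split => // z _ /=; rewrite mem_index_enum.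
by rewrite -fsbig_seq // index_enum_uniq.
Qed.

Section Walk.
Variables (R : realType) (G : multigraph) (o : orientation G) (D : nat).
Variables (d : measure_display) (Omega : measurableType d).
Variables (P : probability Omega R) (x y : vertex G).
Variables (X : nat -> Omega -> vertex G) (A : nat -> Omega -> edge G).
Hypothesis walk : simple_random_walk P x X A.
Hypothesis regG : regular G D.

Definition alive n := [set w | forall i, (i <= n)%N -> X i w <> y].

Definition alive_at n v := [set w | X n w = v] `&` alive n.

Lemma measurable_alive n : measurable (alive n).
Proof.
have -> : alive n = \bigcap_(i in `I_n.+1) ~` [set w | X i w = y].
  by apply/seteqP; split => w h i; exact: (h i).
apply: fin_bigcap_measurable; first exact: finite_II.
by move=> i _; apply: measurableC; exact: srw_measurable_pos walk _ _.
Qed.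

Lemma measurable_alive_at n v : measurable (alive_at n v).
Proof.
by apply: measurableI; [exact: srw_measurable_pos walk _ _|exact: measurable_alive].
Qed.

Definition occupation n v : R := fine (P (alive_at n v)).

Lemma occupationE n v : P (alive_at n v) = (occupation n v)%:E.
Proof. by rewrite fineK // fin_num_measure //; exact: measurable_alive_at. Qed.

Lemma occupation01 n v : 0 <= occupation n v <= 1.
Proof.
rewrite -!lee_fin -occupationE measure_ge0 probability_le1 //.
exact: measurable_alive_at.
Qed.

Lemma occupation_target n : occupation n y = 0.
Proof.
rewrite /occupation (_ : alive_at n y = set0) ?measure0 //.
by apply/seteqP; split => // w [Xy /(_ n (leqnn n))].
Qed.

(* The event is a finite union of cylinders, to which srw_uniform applies. *)
Lemma alive_markov n v a : a \in incident v ->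
  P (alive_at n v `&` [set w | A n w = a]) = (D%:R^-1 * occupation n v)%:E.
Proof.
move=> av.
(* The trajectory up to time n: n + 1 positions, but only n edges. *)
pose t w := ([ffun i : 'I_n.+1 => X i w], [ffun i : 'I_n => A i w]).
have tP (z : {ffun 'I_n.+1 -> vertex G} * {ffun 'I_n -> edge G}) w :
    t w = z <-> (forall i : 'I_n.+1, X i w = z.1 i) /\ (forall i : 'I_n, A i w = z.2 i).
  split=> [<-|[z1 z2]]; first by split => i; rewrite ffunE.
  by rewrite /t [RHS]surjective_pairing; congr (_, _); apply/ffunP => i; rewrite ffunE.
have mt z : measurable (t @^-1` [set z]).
  have -> : t @^-1` [set z] =
      (\bigcap_(i in [set: 'I_n.+1]) [set w | X i w = z.1 i]) `&`
      (\bigcap_(i in [set: 'I_n]) [set w | A i w = z.2 i]).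
    apply/seteqP; split => [w /= /tP[z1 z2]|w [z1 z2]]; first by split => i _ /=.
    by apply/tP; split => i; [exact: z1|exact: z2].
  by apply: measurableI; apply: fin_bigcap_measurable; [exact: finite_finset| |
    exact: finite_finset|] => i _;
    [exact: srw_measurable_pos walk _ _|exact: srw_measurable_edge walk _ _].
have mA := srw_measurable_edge walk n a.
rewrite EFinM -occupationE.
rewrite (measure_partition P (measurable_alive_at n v) mt).
rewrite (measure_partition P (measurableI _ _ (measurable_alive_at n v) mA) mt).
rewrite ge0_sume_distrr //; apply: eq_bigr => z _.
(* A prescribed trajectory that ends at [v] and avoids [y] has its cylinder inside the event; any
   other has its cylinder disjoint from it. *)
have [good|bad] := pselect (z.1 ord_max = v /\ forall i, z.1 i <> y); last first.
  have E0 : alive_at n v `&` t @^-1` [set z] = set0.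
    apply/seteqP; split => // w [[Xv al] /tP[z1 _]]; apply: bad; split.
      by rewrite -z1.
    by move=> i; rewrite -z1; apply: al; rewrite -ltnS.
  by rewrite setIAC E0 set0I measure0 mule0.
have goodE : alive_at n v `&` t @^-1` [set z] = t @^-1` [set z].
  apply/seteqP; split => w; first by case.
  move=> tz; split=> //; move/tP: tz => [z1 _]; split=> /=.
    by rewrite (z1 ord_max) good.1.
  by move=> i ilen; rewrite (z1 (Ordinal (ilen : (i < n.+1)%N))); exact: good.2.
rewrite setIAC goodE.
(* The finite data are extended to infinite sequences. The default [a] matters at index n, where it
   prescribes the next edge. *)
pose vs i := if (i < n.+1)%N =P true is ReflectT h then z.1 (Ordinal h) else v.
pose es i := if (i < n)%N =P true is ReflectT h then z.2 (Ordinal h) else a.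
have vsE (i : 'I_n.+1) : vs i = z.1 i.
  rewrite /vs; case: eqP => [h|]; last by rewrite ltn_ord.
  by congr (z.1 _); exact: val_inj.
have esE (i : 'I_n) : es i = z.2 i.
  rewrite /es; case: eqP => [h|]; last by rewrite ltn_ord.
  by congr (z.2 _); exact: val_inj.
have esn : es n = a by rewrite /es; case: eqP => // h; exfalso; rewrite ltnn in h.
have vsn : vs n = v by rewrite (vsE ord_max) good.1.
have -> : t @^-1` [set z] = [set w | (forall i, (i <= n)%N -> X i w = vs i) /\
                                     (forall i, (i < n)%N -> A i w = es i)].
  apply/seteqP; split => w /=.
    move=> /tP[z1 z2]; split => i ilen.
      by rewrite (z1 (Ordinal (ilen : (i < n.+1)%N))) -vsE.
    by rewrite (z2 (Ordinal ilen)) -esE.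
  move=> [z1 z2]; apply/tP; split => i; first by rewrite -vsE z1 // -ltnS.
  by rewrite -esE z2.
have := @srw_uniform _ _ _ _ _ _ _ _ walk n vs es.
by rewrite /= vsn esn => /(_ av) ->; rewrite regG.
Qed.

(** The walk arrives at [v] through [a] exactly when it stood at the other end of [a] and chose [a],
    which has conditional probability 1/D. As [v] differs from [y], surviving up to time n suffices
    to survive this step. *)
Lemma occupation_step n v : (0 < D)%N -> v != y ->
  occupation n.+1 v = occupation n v - laplacian o (occupation n) v / D%:R.
Proof.
move=> D0 /eqP vy.
have D0' : D%:R != 0 :> R by rewrite pnatr_eq0 -lt0n.
apply: EFin_inj; rewrite -occupationE.
have mA : forall a, measurable (A n @^-1` [set a]) := srw_measurable_edge walk n.
rewrite (measure_partition P (measurable_alive_at n.+1 v) mA).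
rewrite (laplacian_regular o _ _ regG) mulrBl mulrAC mulfV // mul1r opprB addrC subrK.
rewrite mulr_suml -sumEFin [RHS]big_mkcond /=; apply: eq_bigr => a _.
have step w : A n w = a -> ends a = [set X n w; X n.+1 w]%SET.
  by move<-; exact: (srw_traverse walk).
case: ifPn => av; last first.
  rewrite (_ : _ `&` _ = set0) ?measure0 //; apply/seteqP; split => //.
  move=> w [[Xv _] /step E].
  by move: av; rewrite inE E /= -Xv set22.
rewrite mulrC -(alive_markov n (incident_across o av)); congr (P _).
apply/seteqP; split => w [[Xv al] Aa]; have E := step w Aa.
  split=> //; split => [/=|i ilen]; last by apply: al; exact: leqW.
  by apply/eqP; rewrite -(endsE_across _ _ av) E Xv.
have Xw : X n.+1 w = v.
  move/eqP: E; rewrite Xv => /eqP E.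
  have /eqP E' : ends a == [set across o a v; v]%SET by rewrite (endsE_across o).
  have [[s1 d1]|[s1 d1]] := endsP o E; have [[s2 d2]|[s2 d2]] := endsP o E'; congruence.
split=> //; split=> //= i; rewrite leq_eqVlt => /orP[/eqP ->|]; first by rewrite Xw.
exact: al.
Qed.

Hypotheses (D0 : (0 < D)%N) (trees : (0 < #|spanning_trees G|)%N).

Let u := occupation.

Lemma alive_prob n : P (alive n) = (\sum_v u n v)%:E.
Proof.
have mX : forall v, measurable (X n @^-1` [set v]) := srw_measurable_pos walk n.
rewrite (measure_partition P (measurable_alive n) mX) -sumEFin.
by apply: eq_bigr => v _; rewrite -occupationE setIC.
Qed.

Lemma alive_summable : exists C, forall m, \sum_(0 <= n < m) \sum_v u n v <= C.
Proof.
apply: (killed_walk_bounded (o := o) (y := y) D0 trees) => [n v|n|n v].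
- exact: occupation01.
- exact: occupation_target.
- exact: occupation_step.
Qed.

Definition never := [set w | forall i, X i w <> y].

Lemma measurable_never : measurable never.
Proof.
have -> : never = \bigcap_i ~` [set w | X i w = y].
  by apply/seteqP; split => w h i; have := h i => // /(_ I).
by apply: bigcapT_measurable => i; apply: measurableC; exact: srw_measurable_pos walk _ _.
Qed.

(** The event is contained in every [alive n], and the probabilities of these have bounded partial
    sums; a positive constant cannot stay below them all. *)
Lemma never_null : P never = 0%E.
Proof.
have [C uC] := alive_summable.
have Pfin : P never \is a fin_num by rewrite fin_num_measure //; exact: measurable_never.
pose p := fine (P never).
have pE : P never = p%:E by rewrite fineK.
have p0 : 0 <= p by rewrite -lee_fin -pE measure_ge0.
have pu n : p <= \sum_v u n v.
  rewrite -lee_fin -pE -alive_prob; apply: le_measure; rewrite ?inE.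
  - exact: measurable_never.
  - exact: measurable_alive.
  - by move=> w h i _; exact: h.
have pC m : m%:R * p <= C.
  apply: le_trans (uC m); rewrite mulr_natl -[X in _ *+ X]subn0 -sumr_const_nat.
  exact: ler_sum.
rewrite pE; congr EFin; apply/eqP; rewrite eq_le p0 andbT leNgt; apply/negP => pgt0.
have := pC (Num.bound (C / p)); apply/negP; rewrite -ltNge -ltr_pdivrMr //.
by apply: archi_boundP; apply: divr_ge0 => //; have := pC 0; rewrite mul0r.
Qed.

(* Removing the null event [never] makes the partial sums below converge
   everywhere, since signed_transits is 0 there by convention. *)
Definition crossing f n v := alive_at n v `&` [set w | A n w = f] `\` never.

Lemma measurable_crossing f n v : measurable (crossing f n v).
Proof.
apply: measurableD; last exact: measurable_never.
by apply: measurableI; [exact: measurable_alive_at|exact: srw_measurable_edge walk _ _].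
Qed.

Lemma crossing_prob f n v : f \in incident v ->
  P (crossing f n v) = (D%:R^-1 * u n v)%:E.
Proof.
move=> fv; rewrite -(alive_markov n fv).
have mB : measurable (alive_at n v `&` [set w | A n w = f]).
  by apply: measurableI; [exact: measurable_alive_at|exact: srw_measurable_edge walk _ _].
rewrite [RHS](measureDI P mB measurable_never).
rewrite [X in (_ + X)%E](@subset_measure0 _ _ _ P _ never) ?adde0 //.
- by apply: measurableI => //; exact: measurable_never.
- exact: measurable_never.
- exact: never_null.
Qed.

(** * Signed transits and passage to the limit *)

(** The end from which an edge is entered fixes the sense of traversal, so the sign can be read from
    the position before the step. *)
Lemma transitE (f a : edge G) p q : ends a = [set p; q]%SET ->
  transit R o f a p q = (a == f)%:R * ((p == src o f)%:R - (p == dst o f)%:R).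
Proof.
rewrite /transit; case: eqP => [->|_]; last by rewrite mul0r.
rewrite mul1r => /(endsP o)[[<- <-]|[<- <-]]; rewrite !eqxx ?andbT //=.
  by rewrite [dst o f == _]eq_sym andbb.
by rewrite [src o f == _]eq_sym andbb.
Qed.

Definition partial_transits f m w : R :=
  \sum_(0 <= n < m) (\1_(crossing f n (src o f)) w - \1_(crossing f n (dst o f)) w).

Lemma crossing_indic f n w :
  \1_(crossing f n (src o f)) w - \1_(crossing f n (dst o f)) w =
  if `[< alive n w /\ ~ never w >]
  then transit R o f (A n w) (X n w) (X n.+1 w) else 0 :> R.
Proof.
rewrite (transitE _ (srw_traverse walk n w)) !indicE.
have E v : w \in crossing f n v =
    `[< alive n w /\ ~ never w >] && (A n w == f) && (X n w == v).
  apply/idP/idP; rewrite ?inE.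
    by move=> [[[/= -> al] ->] nv]; rewrite !eqxx !andbT; apply/asboolP.
  by move=> /andP[/andP[/asboolP[al nv] /eqP Af] /eqP Xv].
rewrite !E; case: ifP => _ /=; last by rewrite subrr.
by case: (A n w == f); rewrite ?mul1r ?mul0r ?subrr.
Qed.

Lemma partial_transits_cvg f w :
  partial_transits f m w @[m --> \oo] --> signed_transits R o f y (X ^~ w) (A ^~ w).
Proof.
rewrite /partial_transits /signed_transits /hitting_time.
case: pselect => [hit|nohit]; last first.
  apply: cvg_near_cst; apply: nearW => m; apply: big1 => n _.
  rewrite crossing_indic; case: asboolP => // -[_ []] i Xi.
  by apply: nohit; exists i; apply/eqP.
case: ex_minnP => t /eqP Xt tmin.
have aliveE n : `[< alive n w /\ ~ never w >] = (n < t)%N.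
  apply/asboolP/idP => [[al _]|nt].
    by rewrite ltnNge; apply/negP => tn; exact: (al t tn).
  split=> [i ilen /eqP/tmin|/(_ t) //].
  by rewrite leqNgt (leq_ltn_trans ilen nt).
(* From the hitting time [t] on all terms vanish, so the partial sums are constant from index
   [t]. *)
rewrite -(cvg_shiftn t); apply: cvg_near_cst; apply: nearW => m /=.
rewrite (big_cat_nat (n := t)) ?leq_addl //=.
rewrite [X in _ + X]big_nat_cond [X in _ + X]big1 ?addr0.
  by rewrite big_mkord; apply: eq_bigr => n _; rewrite crossing_indic aliveE ltn_ord.
by move=> n /andP[/andP[tn _] _]; rewrite crossing_indic aliveE ltnNge tn.
Qed.

Lemma measurable_partial_transits f m : measurable_fun setT (partial_transits f m).
Proof.
apply: measurable_sum => n; apply: measurable_funB;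
  exact/measurable_indicP/measurable_crossing.
Qed.

Lemma integral_partial_transits f m :
  (\int[P]_w (partial_transits f m w)%:E =
   (D%:R^-1 * (\sum_(0 <= n < m) u n (src o f) -
               \sum_(0 <= n < m) u n (dst o f)))%:E)%E.
Proof.
have int1 n v := integrable_indic P (measurable_crossing f n v).
under eq_integral do rewrite -sumEFin.
rewrite integral_sum //; last first.
  by move=> n; exact: (integrableB measurableT (int1 n _) (int1 n _)).
rewrite -sumrB mulr_sumr -sumEFin; apply: eq_bigr => n _.
under eq_integral do rewrite EFinB.
rewrite integralB_EFin //; [|exact: int1|exact: int1].
rewrite !integral_indic ?setIT //; try exact: measurable_crossing.
by rewrite mulrBr EFinB; congr (_ - _)%E; apply: crossing_prob;
  rewrite (incidentE o) eqxx ?orbT.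
Qed.

(** Pointwise this is the hitting time of [y], infinite on [never]; it serves as dominating
    function, since each step changes the transit count by at most 1. *)
Let alive_time w : \bar R := (\sum_(0 <= n <oo) (\1_(alive n) w)%:E)%E.

Lemma integrable_alive_time : P.-integrable setT alive_time.
Proof.
have m1 n : measurable_fun setT (fun w => (\1_(alive n) w)%:E : \bar R).
  by apply/measurable_EFinP/measurable_indicP; exact: measurable_alive.
apply/integrableP; split.
  exact: ge0_emeasurable_sum.
rewrite (eq_integral alive_time); last first.
  by move=> w _; rewrite gee0_abs //; exact: nneseries_ge0.
rewrite integral_nneseries //.
have [C uC] := alive_summable.
apply: (@le_lt_trans _ _ C%:E); last exact: ltry.
apply: lime_le; first by apply: is_cvg_nneseries => n _ _; exact: integral_ge0.
apply: nearW => m.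
apply: (@le_trans _ _ (\sum_(0 <= n < m) \sum_v u n v)%:E); last by rewrite lee_fin.
rewrite -sumEFin; apply: lee_sum => n _.
by rewrite integral_indic ?setIT -?alive_prob //; exact: measurable_alive.
Qed.

Lemma partial_transits_le f m w : (`|(partial_transits f m w)%:E| <= alive_time w)%E.
Proof.
apply: le_trans (nneseries_lim_ge m _); last by [].
rewrite sumEFin lee_fin; apply: le_trans (ler_norm_sum _ _ _) _.
apply: ler_sum => n _; rewrite crossing_indic indicE.
case: asboolP => [[al _]|_]; last by rewrite normr0.
rewrite mem_set // /transit; case: ifP => _; last by rewrite normr0.
by do 2 case: (_ && _); rewrite ?subrr ?subr0 ?sub0r ?normrN ?normr0 ?normr1.
Qed.

Theorem expected_transits_potential :
  exists2 g : vertex G -> R,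
    forall v, laplacian o g v = (v == x)%:R - (v == y)%:R &
    forall f, expected_transits P o f y X A = g (src o f) - g (dst o f).
Proof.
have [|||g ug lap_g] := @killed_walk_green R G o D y u D0 trees.
- by move=> n v; exact: occupation01.
- exact: occupation_target.
- by move=> n v; exact: occupation_step.
have u0 v : v != y -> u 0 v = (v == x)%:R.
  move=> /eqP vy; apply: EFin_inj; rewrite -occupationE.
  case: eqVneq => [vx|vx].
    rewrite (_ : alive_at _ _ = setT) ?probability_setT //.
    apply/seteqP; split => // w _; split=> [/=|i]; first by rewrite (srw_start walk).
    by rewrite leqn0 => /eqP ->; rewrite (srw_start walk) -vx.
  rewrite (_ : alive_at _ _ = set0) ?measure0 //.
  by apply/seteqP; split => // w [/= + _];
     rewrite (srw_start walk) => xv; rewrite xv eqxx in vx.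
exists g => [v|f].
  case: (eqVneq v y) => [->|vy]; last by rewrite lap_g // u0 // subr0.
  (* The killed walk gives no equation at [y]; the value there is forced because a Laplacian sums to
     zero over all vertices. *)
  have /eqP := sum_laplacian o g; rewrite (bigD1 y) //= addr_eq0 => /eqP ->.
  rewrite (eq_bigr (fun v => (v == x)%:R)); last by move=> w wy; rewrite lap_g // u0.
  case: (eqVneq y x) => [yx|yx].
    by rewrite big1 ?oppr0 ?subrr // => w; rewrite yx => /negPf ->.
  rewrite (bigD1 x) 1?eq_sym //= eqxx big1 ?addr0 ?sub0r //.
  by move=> w /andP[_ /negPf ->].
rewrite /expected_transits unlock.
(* The integrals of the partial transits tend to the expectation by domination, and to the potential
   difference by convergence of the occupation sums. *)
have [] := @dominated_convergence _ _ _ P setT measurableT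
  (fun m w => (partial_transits f m w)%:E)
  (fun w => (signed_transits R o f y (X ^~ w) (A ^~ w))%:E) alive_time.
- by move=> m; apply/measurable_EFinP/measurable_partial_transits.
- apply/measurable_EFinP.
  apply: (measurable_fun_cvg (h := partial_transits f)) => [m|w _].
    exact: measurable_partial_transits.
  exact: partial_transits_cvg.
- by apply: aeW => w _; apply: cvg_EFin; [exact: nearW|exact: partial_transits_cvg].
- exact: integrable_alive_time.
- by apply: aeW => w m _; exact: partial_transits_le.
move=> _ _; under eq_fun do rewrite integral_partial_transits.
move=> lim1.
have lim2 : (D%:R^-1 * (\sum_(0 <= n < m) u n (src o f) -
                        \sum_(0 <= n < m) u n (dst o f)))%:E
    @[m --> \oo] --> (g (src o f) - g (dst o f))%:E.
  apply: cvg_EFin; first exact: nearW.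
  have -> : g (src o f) - g (dst o f) =
      D%:R^-1 * (D%:R * g (src o f) - D%:R * g (dst o f)).
    by rewrite -mulrBr mulKf // pnatr_eq0 -lt0n.
  by apply: cvgMl_tmp; apply: cvgB; exact: ug.
by rewrite (cvg_unique (@ereal_hausdorff R) lim1 lim2).
Qed.
End Walk.

(** * The uniform spanning tree *)

Section UniformTree.
Variables (R : realType) (G : multigraph).
Variables (d : measure_display) (Omega : measurableType d).
Variables (Q : probability Omega R) (T : Omega -> {set edge G}).
Hypothesis ust : uniform_spanning_tree Q T.

(** A space of total probability 1 has a sample point, and the value of T there is a spanning
    tree. *)
Lemma spanning_trees_gt0 : (0 < #|spanning_trees G|)%N.
Proof.
have [E|/set0P[w _]] := eqVneq [set: Omega] set0.
  have := probability_setT Q; rewrite E measure0 => /eqP.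
  by rewrite eq_sym onee_eq0.
by apply/card_gt0P; exists (T w); rewrite inE; apply/asboolP; exact: ust_tree ust w.
Qed.

Lemma ust_prob_containing k (e : 'I_k -> edge G) :
  Q [set w | forall i, e i \in T w] =
  (#|[set S in spanning_trees G | [forall i, e i \in S]]%SET|%:R /
   #|spanning_trees G|%:R)%:E.
Proof.
have mT : forall S, measurable (T @^-1` [set S]) := ust_measurable ust.
have -> : [set w | forall i, e i \in T w] =
    \bigcup_(S in [set S : {set edge G} | forall i, e i \in S]) (T @^-1` [set S]).
  by apply/seteqP; split => [w h|w [S h /= ->//]]; exists (T w).
have mE : measurable (\bigcup_(S in [set S : {set edge G} | forall i, e i \in S])
    (T @^-1` [set S])).
  by apply: fin_bigcup_measurable => //; exact: finite_finset.
rewrite (measure_partition Q mE mT) -sum1_card natr_sum mulr_suml -sumEFin.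
rewrite [RHS]big_mkcond; apply: eq_bigr => S _; rewrite !inE mul1r.
case: asboolP => [ST|nST] /=; last first.
  rewrite (_ : _ `&` _ = set0) ?measure0 //; apply/seteqP; split => // w [_ /= TS].
  by apply: nST; rewrite -TS; exact: ust_tree ust w.
case: forallP => [eS|neS]; last first.
  rewrite (_ : _ `&` _ = set0) ?measure0 //.
  by apply/seteqP; split => // w [[S' h /= ->] /= S'S]; apply: neS; rewrite -S'S.
rewrite -(ust_uniform ust ST); congr (Q _).
by apply/seteqP; split => [w []//|w TS]; split=> //; exists S.
Qed.
End UniformTree.

Theorem theorem1p1 (R : realType) (G : multigraph) (D : nat)
    (o : orientation G)
    (d : measure_display) (Omega : measurableType d) (P : probability Omega R)
    (X : edge G -> nat -> Omega -> vertex G)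
    (A : edge G -> nat -> Omega -> edge G)
    (d' : measure_display) (Omega' : measurableType d')
    (Q : probability Omega' R) (T : Omega' -> {set edge G})
    (k : nat) (e : 'I_k -> edge G) :
  connected_graph G -> regular G D ->
  (forall f : edge G, simple_random_walk P (src o f) (X f) (A f)) ->
  uniform_spanning_tree Q T ->
  injective e ->
  Q [set w | forall i : 'I_k, e i \in T w] =
    (\det (transfer_matrix o P X A e))%:E.
Proof.
move=> [/card_gt0P[r _] _] regG walk ust einj.
have trees := spanning_trees_gt0 ust.
(* Positivity of D is stated relative to an edge, which is incident to its own source; for k = 0 the
   graph may have no edges. *)
have D0 (f : edge G) : (0 < D)%N.
  by rewrite -(regG (src o f)); apply/card_gt0P; exists f; rewrite (incidentE o) eqxx.
have pot i := @expected_transits_potential R G o D d Omega P (src o (e i)) (dst o (e i))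
  (X (e i)) (A (e i)) (walk (e i)) regG (D0 (e i)) trees.
pose g i := s2val (cid2 (pot i)).
rewrite (ust_prob_containing ust) (@card_spanning_trees_containing G o R r k e g einj).
  rewrite mulrAC mulfV ?mul1r ?pnatr_eq0 -?lt0n //; congr (\det _)%:E.
  apply/matrixP => i j; rewrite !mxE /g.
  by case: cid2.
by move=> i v; rewrite /g; case: cid2 => /= gi ->.
Qed.
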